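(* In the setup below, assume $\langle E_{\checkmark,x}\rangle>0$. Then the post-selected non-Hermitian sensing protocol is lossless, i.e. $$4\Big[\langle G_{\checkmark,x}\rangle-\frac{|\langle F_{\checkmark,x}\rangle|^2}{\langle E_{\checkmark,x}\rangle}\Big]=I^Q:=4\big(\langle G_{\Omega,x}\rangle-\langle F_{\Omega,x}\rangle^2\big),$$ if and only if (a) $\partial_x\langle E_{\checkmark,x}\rangle=0$, and (b) for every $j$ and every $t\in[0,T]$, $L_j|\tilde\xi_{\checkmark,x}(t)\rangle=0$, where $|\tilde\xi_{\checkmark,x}(t)\rangle=|\partial_x\tilde\psi_{x|\checkmark}(t)\rangle+i\,\partial_x\theta_{\checkmark,x}|\tilde\psi_{x|\checkmark}(t)\rangle$ and $\partial_x\theta_{\checkmark,x}=-\mathrm{Re}\langle F_{\checkmark,x}\rangle/\langle E_{\checkmark,x}\rangle=\mathrm{Im}\langle\partial_xM_{\checkmark,x}^\dagger(T)M_{\checkmark,x}(T)\rangle/\langle E_{\checkmark,x}\rangle$ (a real number).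
   Context: Let $\mathcal H_S$ be finite-dimensional, $|\psi_i\rangle$ a unit vector, $T>0$. For a real parameter $x$ let $H_{0x}(t)$, $H_1(t)$ be Hermitian operators (continuous in $t$, $C^1$ in $x$), $L_j$ finitely many operators, and $\gamma_j(t)\ge0$ continuous. Non-Hermitian Hamiltonian: $H_x^{nh}(t)=H_{0x}(t)+H_1(t)-\tfrac i2 L^2(t)$ with $L^2(t)=\sum_j\gamma_j(t)L_j^\dagger L_j$. Let $M_{\checkmark,x}(t)$ solve $i\,\tfrac{d}{dt}M_{\checkmark,x}(t)=H_x^{nh}(t)M_{\checkmark,x}(t)$, $M_{\checkmark,x}(0)=\mathbb I$ (time-ordered exponential), and $|\tilde\psi_{x|\checkmark}(t)\rangle=M_{\checkmark,x}(t)|\psi_i\rangle$. With $\langle A\rangle=\langle\psi_i|A|\psi_i\rangle$ and $M=M_{\checkmark,x}(T)$: $E_{\checkmark,x}=M^\dagger M$, $F_{\checkmark,x}=i\,\partial_xM^\dagger M$, $G_{\checkmark,x}=\partial_xM^\dagger\partial_xM$. The quantities of the unitary collision-model dilation (in the continuous-time limit, where jump operators are $\sqrt{\gamma_j(t)dt}\,L_jM_{\checkmark,x}(t)$) are $\langle G_{\Omega,x}\rangle=\langle G_{\checkmark,x}\rangle+\int_0^T\langle\partial_xM_{\checkmark,x}^\dagger(t)L^2(t)\partial_xM_{\checkmark,x}(t)\rangle dt$ and $\langle F_{\Omega,x}\rangle=\langle F_{\checkmark,x}\rangle+i\int_0^T\langle\partial_xM_{\checkmark,x}^\dagger(t)L^2(t)M_{\checkmark,x}(t)\rangle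 dt$. The left side of the displayed equality is $p(\checkmark|x)I(\sigma_{x|\checkmark})$, the post-selection probability times the QFI of the normalized post-selected state $\tilde\psi_{x|\checkmark}(T)/\|\tilde\psi_{x|\checkmark}(T)\|$.
   Formalization: Condition (b) is required only for those j and t with γ_j(t)>0 (it fails as stated for an inactive channel γ_j≡0); differentiability of M in x and the differentiated evolution equation for ∂_xM, which follow from the C^1 dependence on x, are explicit assumptions. *)

(* Defs.v *)
From mathcomp Require Import all_boot all_algebra.
From mathcomp Require Import all_classical all_reals all_analysis.
From mathcomp Require Export complex.
Import GRing.Theory Num.Theory numFieldNormedType.Exports.

Set Implicit Arguments.
Unset Strict Implicit.
Unset Printing Implicit Defensive.

Local Open Scope ring_scope.

Section Defs.
Variable R : realType.
Local Notation C := R[i].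

Definition cR (x : R) : C := Complex x 0.
Definition iC : C := Complex 0 1.

Definition adj {m n : nat} (A : 'M[C]_(m, n)) : 'M[C]_(n, m) :=
  (map_mx Num.conj A)^T.

Definition is_hermitian {n : nat} (A : 'M[C]_n) : Prop := adj A = A.

Definition expect {n : nat} (psi : 'cV[C]_n) (A : 'M[C]_n) : C :=
  (adj psi *m A *m psi) 0 0.

Definition has_cderiv (f : R -> C) (x : R) (d : C) : Prop :=
  is_derive x 1 (fun y => complex.Re (f y)) (complex.Re d) /\
  is_derive x 1 (fun y => complex.Im (f y)) (complex.Im d).

Definition has_mderiv {m n : nat} (f : R -> 'M[C]_(m, n)) (x : R)
  (d : 'M[C]_(m, n)) : Prop :=
  forall i j, has_cderiv (fun y => f y i j) x (d i j).

Definition ccontinuous (f : R -> C) : Prop :=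
  continuous (fun y : R => complex.Re (f y)) /\
  continuous (fun y : R => complex.Im (f y)).

Definition mcontinuous {m n : nat} (f : R -> 'M[C]_(m, n)) : Prop :=
  forall i j, ccontinuous (fun y => f y i j).

Definition cint (T : R) (f : R -> C) : C :=
  Complex (Rintegral lebesgue_measure `[0, T]%classic (fun t => complex.Re (f t)))
          (Rintegral lebesgue_measure `[0, T]%classic (fun t => complex.Im (f t))).

Definition Lsq {n k : nat} (gam : 'I_k -> R -> R) (L : 'I_k -> 'M[C]_n) (t : R)
  : 'M[C]_n :=
  \sum_(j < k) (cR (gam j t)) *: (adj (L j) *m L j).

Definition Hnh {n k : nat} (H0 : R -> R -> 'M[C]_n) (H1 : R -> 'M[C]_n)
  (gam : 'I_k -> R -> R) (L : 'I_k -> 'M[C]_n) (x t : R) : 'M[C]_n :=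
  H0 x t + H1 t - (iC / 2) *: Lsq gam L t.

End Defs.
Arguments iC {R}.

(* Main.v *)
Require Import Defs.
From mathcomp Require Import all_boot all_order all_algebra.
From mathcomp Require Import all_classical all_reals all_analysis.
From mathcomp Require Import complex.
From mathcomp Require Import ring lra.
Import Order.TTheory GRing.Theory Num.Theory numFieldNormedType.Exports.
Local Open Scope ring_scope.

(* Write X = dM x0, Y = M x0, G = L^2, e = <Y^* Y>(T), <X^* Y>(T) = ar + i ai.
   Differentiating <Y^* Y> and <X^* Y> in t, only the decay rate G and (for the
   latter) a purely imaginary source survive, so the integral of <Y^* G Y> is
   1 - e and that of <X^* G Y> has real part - ar; call bi its imaginary part and
   D the integral of <X^* G X>.  Then F_Omega = - (ai + bi) is real, and
     Q(p, q) := int <(X + w Y)^* G (X + w Y)>, with w = p + i q,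
   equals D - 2 (p ar + q bi) + (p^2 + q^2) (1 - e) >= 0.  Losslessness reads
   D + (ar^2 + ai^2) / e = (ai + bi)^2, while (a) is ar = 0 and (b) is
   Q(0, ai / e) = 0.  The two are equivalent thanks to the single inequality
   Q(ar, ai + bi) >= 0, a quantitative form of Cauchy-Schwarz. *)

Section ComplexParts.
Set Implicit Arguments.
Unset Strict Implicit.

Variable R : realType.
Implicit Types x y : R[i].

Lemma cReD x y : complex.Re (x + y) = complex.Re x + complex.Re y.
Proof. by case: x => a b; case: y => c d. Qed.

Lemma cImD x y : complex.Im (x + y) = complex.Im x + complex.Im y.
Proof. by case: x => a b; case: y => c d. Qed.

Lemma cReN x : complex.Re (- x) = - complex.Re x.
Proof. by case: x. Qed.

Lemma cReM x y : complex.Re (x * y) =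
  complex.Re x * complex.Re y - complex.Im x * complex.Im y.
Proof. by case: x => a b; case: y => c d. Qed.

Lemma cImM x y : complex.Im (x * y) =
  complex.Re x * complex.Im y + complex.Im x * complex.Re y.
Proof. by case: x => a b; case: y => c d. Qed.

Lemma cRe_conj x : complex.Re (Num.conj x) = complex.Re x.
Proof. by case: x. Qed.

Lemma cIm_conj x : complex.Im (Num.conj x) = - complex.Im x.
Proof. by case: x. Qed.

Lemma complexP x y :
  complex.Re x = complex.Re y -> complex.Im x = complex.Im y -> x = y.
Proof. by case: x => a b; case: y => c d /= -> ->. Qed.

Lemma cR_div (a b : R) : cR a / cR b = cR (a / b).
Proof. by rewrite -[cR a]/(a%:C)%C -[cR b]/(b%:C)%C -fmorphV -rmorphM. Qed.

Lemma cR_sqr (a : R) : cR a ^+ 2 = cR (a ^+ 2).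
Proof. by rewrite -[cR a]/(a%:C)%C -rmorphXn. Qed.

Lemma cRD (a b : R) : cR a + cR b = cR (a + b).
Proof. by rewrite -[cR a]/(a%:C)%C -[cR b]/(b%:C)%C -rmorphD. Qed.

Lemma cRN (a : R) : - cR a = cR (- a).
Proof. by rewrite -[cR a]/(a%:C)%C -rmorphN. Qed.

Lemma eq_mul4_subcR x (u v w : R) :
  4 * (x - cR u) = 4 * (x + cR v - cR w) <-> v + u = w.
Proof.
have n40 : (4 : R[i]) != 0 by rewrite pnatr_eq0.
split=> [/(mulfI n40)|<-]; first by case: x => a b [] h _; lra.
congr (_ * _); rewrite -addrA cRN cRN cRD; congr (_ + cR _); ring.
Qed.

Lemma sqr_norm_cR x : `|x| ^+ 2 = cR (complex.Re x ^+ 2 + complex.Im x ^+ 2).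
Proof. by rewrite normc_def -rmorphXn sqr_sqrtr ?addr_ge0 ?sqr_ge0. Qed.

End ComplexParts.

Section Integrals.
Set Implicit Arguments.
Unset Strict Implicit.

Local Open Scope classical_set_scope.
Local Open Scope ring_scope.
Variable R : realType.
Notation leb := (@lebesgue_measure R).

Lemma continuous_integrable_itv (a b : R) (f : R -> R) : continuous f ->
  leb.-integrable `[a, b]%classic (EFin \o f).
Proof.
move=> cf; apply: continuous_compact_integrable; first exact: segment_compact.
exact: continuous_subspaceT.
Qed.

Lemma Rintegral_FTC2 (T : R) (f F : R -> R) : 0 < T -> continuous f ->
  (forall t : R, is_derive t 1 F (f t)) ->
  Rintegral leb `[0, T]%classic f = F T - F 0.
Proof.
move=> T0 cf dF.
have cF : continuous F.
  by move=> t; apply/differentiable_continuous/derivable1_diffP; case: (dF t).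
rewrite /Rintegral (@continuous_FTC2 _ _ F)//.
- exact: continuous_subspaceT.
- split; first by move=> t _; case: (dF t).
  + exact/cvg_at_right_filter/cF.
  + exact/cvg_at_left_filter/cF.
- by move=> t _; rewrite derive1E; case: (dF t).
Qed.

Lemma Rintegral_FTC2N (T : R) (f F : R -> R) : 0 < T -> continuous f ->
  (forall t : R, is_derive t 1 F (- f t)) ->
  Rintegral leb `[0, T]%classic f = F 0 - F T.
Proof.
move=> T0 cf dF.
have dNF (t : R) : is_derive t 1 (- F) (f t).
  by rewrite -[f t]opprK; exact: is_deriveN.
by rewrite (Rintegral_FTC2 T0 cf dNF) opprK addrC.
Qed.

Lemma continuous_ge0_Rintegral_eq0 (T : R) (f : R -> R) : 0 < T ->
  continuous f -> (forall t, 0 <= f t) ->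
  Rintegral leb `[0, T]%classic f = 0 ->
  forall t : R, 0 <= t <= T -> f t = 0.
Proof.
move=> T0 cf f0 If.
pose g x := Rintegral leb `[0, x]%classic f.
have g0 x : 0 < x < T -> g x = 0.
  move=> /andP[x0 xT]; apply/eqP; rewrite eq_le Rintegral_ge0 ?andbT//.
  rewrite -If -subr_ge0 Rintegral_itvB ?bnd_simp ?(ltW x0) ?(ltW xT)//.
    exact: Rintegral_ge0.
  exact: continuous_integrable_itv.
have fin t : 0 < t < T -> f t = 0.
  move=> t0T; have /andP[t0 tT] := t0T.
  have [dg <-] := @continuous_FTC1_closed R f 0 t T tT
    (continuous_integrable_itv 0 T cf) t0 (cf t).
  rewrite derive1E.
  transitivity ('D_1 (cst 0 : R -> R) t); last exact: derive_cst.
  apply: near_eq_derive => //.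
  have : t \in `]0, T[ by rewrite in_itv.
  move/near_in_itvoo; apply: filterS => y; rewrite in_itv/= => yT.
  exact: g0.
move=> t /andP[]; rewrite !le_eqVlt => /predU1P[<-|t0] /predU1P[tT|tT].
- by rewrite tT ltxx in T0.
- apply: (@cvg_unique _ _ (f x @[x --> 0^'+])) => //.
    exact/cvg_at_right_filter/cf.
  apply: cvg_near_cst; near=> x; by apply: fin; apply/andP; split.
- rewrite tT; apply: (@cvg_unique _ _ (f x @[x --> T^'-])) => //.
    exact/cvg_at_left_filter/cf.
  apply: cvg_near_cst; near=> x; by apply: fin; apply/andP; split.

- by apply: fin; rewrite t0.
Unshelve. all: by end_near. Qed.
End Integrals.

Section Calculus.
Set Implicit Arguments.
Unset Strict Implicit.

Variable R : realType.
Notation C := R[i].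
Notation Re := complex.Re.
Notation Im := complex.Im.

Lemma has_cderiv_cst (c : C) x : has_cderiv (fun=> c) x 0.
Proof. by split; exact: is_derive_cst. Qed.

Lemma has_cderivD (f g : R -> C) x df dg : has_cderiv f x df ->
  has_cderiv g x dg -> has_cderiv (fun y => f y + g y) x (df + dg).
Proof.
move=> [fr fi] [gr gi]; split.
- under eq_fun do rewrite cReD; rewrite cReD; exact: is_deriveD.
- under eq_fun do rewrite cImD; rewrite cImD; exact: is_deriveD.
Qed.

Lemma has_cderivM (f g : R -> C) x df dg : has_cderiv f x df ->
  has_cderiv g x dg -> has_cderiv (fun y => f y * g y) x (df * g x + f x * dg).
Proof.
move=> [fr fi] [gr gi]; split.
- under eq_fun do rewrite cReM.
  by apply: (is_derive_eq (is_deriveB (is_deriveM fr gr) (is_deriveM fi gi)));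
    rewrite cReD !cReM /GRing.scale/=; ring.
- under eq_fun do rewrite cImM.
  by apply: (is_derive_eq (is_deriveD (is_deriveM fr gi) (is_deriveM fi gr)));
    rewrite cImD !cImM /GRing.scale/=; ring.
Qed.

Lemma has_cderiv_conj (f : R -> C) x df : has_cderiv f x df ->
  has_cderiv (fun y => Num.conj (f y)) x (Num.conj df).
Proof.
move=> [fr fi]; split.
- by under eq_fun do rewrite cRe_conj; rewrite cRe_conj.
- by under eq_fun do rewrite cIm_conj; rewrite cIm_conj; exact: is_deriveN.
Qed.

Lemma has_cderiv_sum (I : Type) (r : seq I) (f : I -> R -> C) x (df : I -> C) :
  (forall i, has_cderiv (f i) x (df i)) ->
  has_cderiv (fun y => \sum_(i <- r) f i y) x (\sum_(i <- r) df i).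
Proof.
move=> h; elim: r => [|i r IH].
  under eq_fun do rewrite big_nil; rewrite big_nil; exact: has_cderiv_cst.
under eq_fun do rewrite big_cons; rewrite big_cons; exact: has_cderivD.
Qed.

Lemma has_cderiv_unique (f : R -> C) x a b :
  has_cderiv f x a -> has_cderiv f x b -> a = b.
Proof.
move=> [fr fi] [gr gi]; apply: complexP.
- by case: fr => _ <-; case: gr.
- by case: fi => _ <-; case: gi.
Qed.

Lemma has_mderiv_unique m n (f : R -> 'M[C]_(m, n)) x a b :
  has_mderiv f x a -> has_mderiv f x b -> a = b.
Proof. by move=> fa fb; apply/matrixP => i j; exact: has_cderiv_unique. Qed.

Lemma has_mderiv_cst m n (A : 'M[C]_(m, n)) x : has_mderiv (fun=> A) x 0.
Proof. by move=> i j; rewrite mxE; exact: has_cderiv_cst. Qed.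

Lemma has_mderivM m n p (f : R -> 'M[C]_(m, n)) (g : R -> 'M[C]_(n, p)) x df dg :
  has_mderiv f x df -> has_mderiv g x dg ->
  has_mderiv (fun y => f y *m g y) x (df *m g x + f x *m dg).
Proof.
move=> hf hg i j; under eq_fun do rewrite mxE.
by rewrite !mxE -big_split; apply: has_cderiv_sum => k; exact: has_cderivM.
Qed.

Lemma has_mderiv_adj m n (f : R -> 'M[C]_(m, n)) x df :
  has_mderiv f x df -> has_mderiv (fun y => adj (f y)) x (adj df).
Proof.
move=> hf i j; under eq_fun do rewrite !mxE.
by rewrite !mxE; exact: has_cderiv_conj.
Qed.

Lemma has_mderiv_continuous m n (f df : R -> 'M[C]_(m, n)) :
  (forall x, has_mderiv f x (df x)) -> mcontinuous f.
Proof.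
move=> h i j; split=> x; apply/differentiable_continuous/derivable1_diffP.
- by have [[]] := h x i j.
- by have [_ []] := h x i j.
Qed.

Lemma ccontinuous_cst (c : C) : ccontinuous (fun=> c : C).
Proof. by split=> x; exact: cvg_cst. Qed.

Lemma ccontinuousD (f g : R -> C) : ccontinuous f -> ccontinuous g ->
  ccontinuous (fun y => f y + g y).
Proof.
move=> [fr fi] [gr gi]; split=> x.
- by under eq_fun do rewrite cReD; apply: cvgD; [exact: fr|exact: gr].
- by under eq_fun do rewrite cImD; apply: cvgD; [exact: fi|exact: gi].
Qed.

Lemma ccontinuousM (f g : R -> C) : ccontinuous f -> ccontinuous g ->
  ccontinuous (fun y => f y * g y).
Proof.
move=> [fr fi] [gr gi]; split=> x.
- under eq_fun do rewrite cReM.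
  by apply: cvgB; apply: cvgM; [exact: fr|exact: gr|exact: fi|exact: gi].
- under eq_fun do rewrite cImM.
  by apply: cvgD; apply: cvgM; [exact: fr|exact: gi|exact: fi|exact: gr].
Qed.

Lemma ccontinuous_conj (f : R -> C) : ccontinuous f ->
  ccontinuous (fun y => Num.conj (f y)).
Proof.
move=> [fr fi]; split=> x.
- by under eq_fun do rewrite cRe_conj; exact: fr.
- by under eq_fun do rewrite cIm_conj; apply: cvgN; exact: fi.
Qed.

Lemma ccontinuous_sum (I : Type) (r : seq I) (f : I -> R -> C) :
  (forall i, ccontinuous (f i)) -> ccontinuous (fun y => \sum_(i <- r) f i y).
Proof.
move=> h; elim: r => [|i r IH].
  under eq_fun do rewrite big_nil; exact: ccontinuous_cst.
under eq_fun do rewrite big_cons; exact: ccontinuousD.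
Qed.

Lemma mcontinuous_cst m n (A : 'M[C]_(m, n)) :
  mcontinuous (fun=> A : 'M[C]_(m, n)).
Proof. by move=> i j; exact: ccontinuous_cst. Qed.

Lemma mcontinuousM m n p (f : R -> 'M[C]_(m, n)) (g : R -> 'M[C]_(n, p)) :
  mcontinuous f -> mcontinuous g -> mcontinuous (fun y => f y *m g y).
Proof.
move=> hf hg i j; under eq_fun do rewrite mxE.
by apply: ccontinuous_sum => k; exact: ccontinuousM.
Qed.

Lemma mcontinuous_adj m n (f : R -> 'M[C]_(m, n)) :
  mcontinuous f -> mcontinuous (fun y => adj (f y)).
Proof.
by move=> hf i j; under eq_fun do rewrite !mxE; exact: ccontinuous_conj.
Qed.

Lemma mcontinuousD m n (f g : R -> 'M[C]_(m, n)) :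
  mcontinuous f -> mcontinuous g -> mcontinuous (fun y => f y + g y).
Proof.
by move=> hf hg i j; under eq_fun do rewrite mxE; exact: ccontinuousD.
Qed.

Lemma mcontinuousZ m n (c : C) (f : R -> 'M[C]_(m, n)) :
  mcontinuous f -> mcontinuous (fun y => c *: f y).
Proof.
move=> hf i j; under eq_fun do rewrite mxE.
by apply: ccontinuousM => //; exact: ccontinuous_cst.
Qed.

Lemma mcontinuous_Lsq n k (gam : 'I_k -> R -> R) (L : 'I_k -> 'M[C]_n) :
  (forall j, continuous (gam j)) -> mcontinuous (Lsq gam L).
Proof.
move=> cg i j; rewrite /Lsq; under eq_fun do rewrite summxE.
apply: ccontinuous_sum => l; under eq_fun do rewrite mxE.
apply: ccontinuousM; last exact: ccontinuous_cst.
by split=> [|x]; [exact: cg|exact: cvg_cst].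
Qed.

End Calculus.

Section Expectation.
Set Implicit Arguments.
Unset Strict Implicit.

Variable R : realType.
Notation C := R[i].
Notation Re := complex.Re.
Notation Im := complex.Im.

Lemma adj0 m n : adj (0 : 'M[C]_(m, n)) = 0.
Proof. by rewrite /adj map_mx0 trmx0. Qed.

Lemma adjM m n p (A : 'M[C]_(m, n)) (B : 'M[C]_(n, p)) :
  adj (A *m B) = adj B *m adj A.
Proof. by rewrite /adj map_mxM trmx_mul. Qed.

Lemma adjD m n (A B : 'M[C]_(m, n)) : adj (A + B) = adj A + adj B.
Proof. by rewrite /adj map_mxD linearD. Qed.

Lemma adjN m n (A : 'M[C]_(m, n)) : adj (- A) = - adj A.
Proof. by rewrite /adj map_mxN linearN. Qed.

Lemma adjZ m n (c : C) (A : 'M[C]_(m, n)) : adj (c *: A) = Num.conj c *: adj A.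
Proof. by rewrite /adj map_mxZ linearZ. Qed.

Lemma adjK m n (A : 'M[C]_(m, n)) : adj (adj A) = A.
Proof. by apply/matrixP => i j; rewrite !mxE conjCK. Qed.

Lemma adj_Lsq n k (gam : 'I_k -> R -> R) (L : 'I_k -> 'M[C]_n) t :
  adj (Lsq gam L t) = Lsq gam L t.
Proof.
rewrite /Lsq; elim/big_ind : _ => [|A B eA eB|j _].
- by apply/matrixP => i j; rewrite !mxE conjC0.
- by rewrite adjD eA eB.
- rewrite adjZ adjM adjK; congr (_ *: _).
  by apply: complexP; rewrite ?cRe_conj ?cIm_conj/= ?oppr0.
Qed.

Variables (n : nat) (psi : 'cV[C]_n).
Implicit Types A B : 'M[C]_n.

Lemma expect0 : expect psi 0 = 0.
Proof. by rewrite /expect mulmx0 mul0mx mxE. Qed.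

Lemma expectD A B : expect psi (A + B) = expect psi A + expect psi B.
Proof. by rewrite /expect mulmxDr mulmxDl mxE. Qed.

Lemma expectN A : expect psi (- A) = - expect psi A.
Proof. by rewrite /expect mulmxN mulNmx mxE. Qed.

Lemma expectZ c A : expect psi (c *: A) = c * expect psi A.
Proof. by rewrite /expect -scalemxAr -scalemxAl mxE. Qed.

Lemma expect_sum (I : Type) (r : seq I) (A : I -> 'M[C]_n) :
  expect psi (\sum_(i <- r) A i) = \sum_(i <- r) expect psi (A i).
Proof. by rewrite /expect mulmx_sumr mulmx_suml summxE. Qed.

Lemma expect_adj A : expect psi (adj A) = Num.conj (expect psi A).
Proof.
by rewrite /expect -[X in (_ *m _ *m X) 0 0]adjK -!adjM mulmxA !mxE.
Qed.

Lemma expect_adjM A : expect psi (adj A *m A) = \sum_i `|(A *m psi) i 0| ^+ 2.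
Proof.
rewrite /expect mulmxA -adjM -mulmxA mxE; apply: eq_bigr => i _.
by rewrite !mxE normCK mulrC.
Qed.

Lemma Im_expect_herm A : is_hermitian A -> Im (expect psi A) = 0.
Proof.
move=> /(congr1 (expect psi)); rewrite expect_adj.
by move=> /(congr1 (fun z => Im z)); rewrite cIm_conj; lra.
Qed.

Lemma Re_expect_adjM_ge0 A : 0 <= Re (expect psi (adj A *m A)).
Proof.
have : 0 <= expect psi (adj A *m A).
  by rewrite expect_adjM sumr_ge0// => i _; rewrite exprn_ge0.
by rewrite lecE => /andP[].
Qed.

Lemma Re_expect_adjM_eq0 A : Re (expect psi (adj A *m A)) = 0 <-> A *m psi = 0.
Proof.
split=> [A0|Ap0]; last first.
  by rewrite /expect -!mulmxA Ap0 !mulmx0 mxE.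
have {A0} : expect psi (adj A *m A) = 0.
  apply: complexP; rewrite ?A0//.
  by apply: Im_expect_herm; rewrite /is_hermitian adjM adjK.
rewrite expect_adjM => /eqP; rewrite psumr_eq0 => [|i _]; last exact: exprn_ge0.
move=> /allP h; apply/matrixP => i j; rewrite [RHS]mxE ord1; apply/eqP.
by have := h i (mem_index_enum _); rewrite /= expf_eq0 normr_eq0.
Qed.

Lemma has_cderiv_expect (f : R -> 'M[C]_n) x df : has_mderiv f x df ->
  has_cderiv (fun y => expect psi (f y)) x (expect psi df).
Proof.
move=> h.
have := has_mderivM (has_mderivM (has_mderiv_cst (adj psi) x) h)
  (has_mderiv_cst psi x).
by move=> /(_ 0 0); rewrite mul0mx add0r mulmx0 addr0.
Qed.

Lemma ccontinuous_expect (f : R -> 'M[C]_n) : mcontinuous f ->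
  ccontinuous (fun y => expect psi (f y)).
Proof.
move=> h; have := mcontinuousM
  (mcontinuousM (mcontinuous_cst (adj psi)) h) (mcontinuous_cst psi).
exact.
Qed.

End Expectation.

Section RealAlgebra.
Set Implicit Arguments.
Unset Strict Implicit.

Lemma quadratic_lossless (R : realFieldType) (e ar ai bi D : R) : 0 < e ->
  (forall p q, 0 <= D + 2 * (p * - ar - q * bi) + (p ^+ 2 + q ^+ 2) * (1 - e)) ->
  D + (ar ^+ 2 + ai ^+ 2) / e = (ai + bi) ^+ 2 <->
  ar = 0 /\
  D + 2 * (0 * - ar - ai / e * bi) + (0 ^+ 2 + (ai / e) ^+ 2) * (1 - e) = 0.
Proof.
move=> e0 Q; have en0 : e != 0 by rewrite gt_eqF.
pose s := ar / e; pose th := ai / e.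
have Ear : ar = s * e by rewrite /s divfK.
have Eai : ai = th * e by rewrite /th divfK.
have -> : (ar ^+ 2 + ai ^+ 2) / e = (s ^+ 2 + th ^+ 2) * e.
  by rewrite Ear Eai; field.
have := Q ar (ai + bi); rewrite -/th Ear Eai {Q}.
pose d := th - (th * e + bi).
have -> : bi = th - th * e - d by rewrite /d; ring.
clearbody s th d; clear Ear Eai => Q.
have e2 : 0 < e ^+ 2 by rewrite exprn_gt0.
have s2 := sqr_ge0 s; have d2 := sqr_ge0 d.
have es : 0 <= e * s ^+ 2 by rewrite mulr_ge0// ltW.
have ees : 0 <= e ^+ 2 * s ^+ 2 by rewrite mulr_ge0// ltW.
have eees : 0 <= e ^+ 3 * s ^+ 2 by rewrite mulr_ge0// ltW ?exprn_gt0.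
have ed : 0 <= e * d ^+ 2 by rewrite mulr_ge0// ltW.
split=> [H|[/eqP]].
- have DE : D = (th - d) ^+ 2 - (s ^+ 2 + th ^+ 2) * e by lra.
  have K : e * d ^+ 2 + e * s ^+ 2 + e ^+ 2 * s ^+ 2 + e ^+ 3 * s ^+ 2 <= 0.
    by move: Q; rewrite DE; lra.
  have /eqP : e * d ^+ 2 = 0 by lra.
  have /eqP : e * s ^+ 2 = 0 by lra.
  rewrite !mulf_eq0 (negbTE en0) !orbb => /eqP s0 /eqP d0.
  by split; [rewrite s0 mul0r|rewrite DE s0 d0; ring].
- rewrite mulf_eq0 (negbTE en0) orbF => /eqP s0 X0.
  have DE : D = 2 * th * (th - th * e - d) - th ^+ 2 * (1 - e).
    by lra.
  have K : (1 + e) * d ^+ 2 <= 0.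
    by move: Q; rewrite DE s0; lra.
  have /eqP : d ^+ 2 = 0 by lra.
  by rewrite expf_eq0/= => /eqP d0; rewrite DE s0 d0; ring.
Qed.

End RealAlgebra.

Section QuadraticForm.
Set Implicit Arguments.
Unset Strict Implicit.

Variable R : realType.
Notation C := R[i].
Notation Re := complex.Re.
Notation Im := complex.Im.
Notation leb := (@lebesgue_measure R).

Lemma iC_sqr : (iC : C) * iC = -1.
Proof.
by apply: complexP => /=; rewrite ?mulr0 ?mul0r ?mulr1 ?sub0r ?addr0 ?oppr0.
Qed.

Lemma conj_iC : Num.conj (iC : C) = - iC.
Proof. by apply: complexP; rewrite ?cRe_conj ?cIm_conj/= ?oppr0. Qed.

Lemma Rintegral_quadratic (T : R) (f g h k : R -> R) (p q c : R) :
  continuous f -> continuous g -> continuous h -> continuous k ->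
  Rintegral leb `[0, T]%classic
    (fun t => f t + 2 * (p * g t - q * h t) + c * k t) =
  Rintegral leb `[0, T]%classic f +
  2 * (p * Rintegral leb `[0, T]%classic g -
       q * Rintegral leb `[0, T]%classic h) +
  c * Rintegral leb `[0, T]%classic k.
Proof.
move=> cf cg ch ck.
have cM a (u : R -> R) : continuous u -> continuous (fun t => a * u t).
  by move=> cu t; apply: cvgM; [exact: cvg_cst|exact: cu].
have cgh : continuous (fun t => p * g t - q * h t).
  by move=> t; apply: cvgB; [exact: (cM p g)|exact: (cM q h)].
have cfgh : continuous (fun t => f t + 2 * (p * g t - q * h t)).
  by move=> t; apply: cvgD; [exact: cf|exact: (cM 2 _ cgh)].
have I u := @continuous_integrable_itv R 0 T u.
rewrite RintegralD//; [|exact: I|exact/I/cM].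
rewrite RintegralD//; [|exact: I|exact/I/cM].
rewrite !RintegralZl//; [|exact: I|exact: I].
rewrite RintegralB//; [|exact/I/cM|exact/I/cM].
by rewrite !RintegralZl//; exact: I.
Qed.

Section Matrices.
Variables (n : nat) (psi : 'cV[C]_n).
Implicit Types X Y P K G : 'M[C]_n.

(* The Hermitian part of the generator cancels; only its decay rate [G] and the
   source term [P] survive. *)
Lemma adj_mul_schrodinger K G X Y P : is_hermitian K -> is_hermitian G ->
  let H := K - (iC / 2) *: G in
  adj (- iC *: (H *m X + P)) *m Y + adj X *m (- iC *: (H *m Y)) =
  - (adj X *m G *m Y) + iC *: (adj P *m Y).
Proof.
move=> hK hG H.
have hc : Num.conj (iC / 2 : C) = - (iC / 2).
  by rewrite rmorphM fmorphV/= conj_iC conjC_nat mulNr.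
have hH : adj H = H + iC *: G.
  rewrite /H adjD adjN adjZ hK hG hc scaleNr opprK -addrA; congr (_ + _).
  by rewrite addrC -scaleNr -scalerDl; congr (_ *: _); field.
clearbody H; rewrite adjZ rmorphN /= conj_iC opprK adjD adjM hH mulmxDr !scalerDr.
rewrite -scalemxAr -scalemxAr scalerA iC_sqr scaleN1r scaleNr.
rewrite !mulmxDl -!scalemxAl mulNmx mulmxA.
by rewrite addrAC [X in X + _]addrAC subrr add0r.
Qed.

Lemma Re_expect_schrodinger K G X Y P : is_hermitian K -> is_hermitian G ->
  let H := K - (iC / 2) *: G in
  Re (expect psi (adj (- iC *: (H *m X + P)) *m Y +
                  adj X *m (- iC *: (H *m Y)))) =
  - Re (expect psi (adj X *m G *m Y)) - Im (expect psi (adj P *m Y)).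
Proof.
move=> hK hG H; rewrite adj_mul_schrodinger//.
rewrite (expectD psi (- _) (_ *: _)) (expectN psi (_ *m _)) (expectZ psi iC).
by rewrite cReD cReN cReM mul0r sub0r mul1r.
Qed.

Lemma Re_expect_quadratic G X Y (w : C) : is_hermitian G ->
  Re (expect psi (adj (X + w *: Y) *m G *m (X + w *: Y))) =
  Re (expect psi (adj X *m G *m X)) +
  2 * (Re w * Re (expect psi (adj X *m G *m Y)) -
       Im w * Im (expect psi (adj X *m G *m Y))) +
  (Re w ^+ 2 + Im w ^+ 2) * Re (expect psi (adj Y *m G *m Y)).
Proof.
move=> hG.
have hYX : expect psi (adj Y *m G *m X) = Num.conj (expect psi (adj X *m G *m Y)).
  by rewrite -expect_adj !adjM adjK hG mulmxA.
have hYY : Im (expect psi (adj Y *m G *m Y)) = 0.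
  by apply: Im_expect_herm; rewrite /is_hermitian !adjM adjK hG mulmxA.
rewrite adjD adjZ !mulmxDl !mulmxDr -!scalemxAl -!scalemxAr scalerA.
have eD4 A B A' B' :
    expect psi (A + w *: B + (Num.conj w *: A' + (Num.conj w * w) *: B')) =
    expect psi A + w * expect psi B +
    (Num.conj w * expect psi A' + Num.conj w * w * expect psi B').
  by rewrite -!expectZ -!expectD.
rewrite {}eD4 hYX; move: hYY.
move: (expect _ _) (expect _ _) (expect _ _) w.
move=> [yr yi] [xyr xyi] [xr xi] [p q] /= ->; ring.
Qed.

Lemma Re_expect_Lsq k (gam : 'I_k -> R -> R) (L : 'I_k -> 'M[C]_n) t W :
  Re (expect psi (adj W *m Lsq gam L t *m W)) =
  \sum_j gam j t * Re (expect psi (adj (L j *m W) *m (L j *m W))).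
Proof.
rewrite /Lsq mulmx_sumr mulmx_suml expect_sum.
rewrite (big_morph (fun z : C => Re z) (@cReD R) (erefl _)).
apply: eq_bigr => j _; rewrite -scalemxAr -scalemxAl expectZ cReM mul0r subr0.
by rewrite adjM !mulmxA.
Qed.

End Matrices.

End QuadraticForm.

(* Convention: M x t = M_{checkmark,x}(t), dM x t = d/dx M_{checkmark,x}(t),
   H0 x t = H_{0x}(t), dH0 x t = d/dx H_{0x}(t); the theorem is stated at x = x0. *)
Theorem theorem2 (R : realType) (n k : nat)
  (psi : 'cV[R[i]]_n) (T : R)
  (H0 dH0 : R -> R -> 'M[R[i]]_n) (H1 : R -> 'M[R[i]]_n)
  (L : 'I_k -> 'M[R[i]]_n) (gam : 'I_k -> R -> R)
  (M dM : R -> R -> 'M[R[i]]_n) (x0 : R) :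
  (* unit initial state, T > 0 *)
  expect psi 1%:M = 1 ->
  0 < T ->
  (* Hamiltonians: Hermitian, continuous in t, C^1 in x *)
  (forall (x t : R), is_hermitian (H0 x t)) ->
  (forall t : R, is_hermitian (H1 t)) ->
  (forall x : R, mcontinuous (H0 x)) ->
  mcontinuous H1 ->
  (forall (x t : R), has_mderiv (fun y => H0 y t) x (dH0 x t)) ->
  (forall x : R, mcontinuous (dH0 x)) ->
  (forall t : R, mcontinuous (fun y => dH0 y t)) ->
  (* rates: nonnegative and continuous *)
  (forall j (t : R), 0 <= gam j t) ->
  (forall j, continuous (gam j)) ->
  (* M solves i dM/dt = H^nh M, M(0) = I *)
  (forall x : R, M x 0 = 1%:M) ->
  (forall (x t : R), has_mderiv (M x) t (- iC *: (Hnh H0 H1 gam L x t *m M x t))) ->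
  (* regularity in x (consequence of the C^1 dependence; see NOTES.md) *)
  (forall (x t : R), has_mderiv (fun y => M y t) x (dM x t)) ->
  (forall (x t : R), has_mderiv (dM x) t
     (- iC *: (Hnh H0 H1 gam L x t *m dM x t + dH0 x t *m M x t))) ->
  let E := fun x => expect psi (adj (M x T) *m M x T) in
  let F := iC * expect psi (adj (dM x0 T) *m M x0 T) in
  let G := expect psi (adj (dM x0 T) *m dM x0 T) in
  let GO := G + cint T (fun t =>
              expect psi (adj (dM x0 t) *m Lsq gam L t *m dM x0 t)) in
  let FO := F + iC * cint T (fun t =>
              expect psi (adj (dM x0 t) *m Lsq gam L t *m M x0 t)) in
  let dtheta := - cR (complex.Re F) / E x0 in
  let xi := fun t => dM x0 t *m psi + (iC * dtheta) *: (M x0 t *m psi) in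
  0 < E x0 ->
  (4 * (G - `|F| ^+ 2 / E x0) = 4 * (GO - FO ^+ 2)
   <->
   has_cderiv E x0 0 /\
   (forall j (t : R), 0 <= t <= T -> 0 < gam j t -> L j *m xi t = 0)).
Proof.
move=> psi1 T0 hH0 hH1 cH0 cH1 dH0E cdH0 cdH0x gam0 cgam M0 dtM dxM dtdM.
move=> E F G GO FO dtheta xi E0.
pose X t := dM x0 t; pose Y t := M x0 t; pose Ga t := Lsq gam L t.
have hGa t : is_hermitian (Ga t) by exact: adj_Lsq.
have cGa : mcontinuous Ga by exact: mcontinuous_Lsq.
have cX : mcontinuous X by exact: has_mderiv_continuous (dtdM x0).
have cY : mcontinuous Y by exact: has_mderiv_continuous (dtM x0).
have hdH0 x t : is_hermitian (dH0 x t).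
  apply: (has_mderiv_unique (f := fun y => adj (H0 y t)) (x := x)).
    exact: has_mderiv_adj.
  rewrite (_ : (fun y => _) = fun y => H0 y t)//; apply/funext => y; exact: hH0.
have X0 : X 0 = 0.
  apply: (has_mderiv_unique (f := fun y => M y 0) (x := x0)); first exact: dxM.
  under eq_fun do rewrite M0; exact: has_mderiv_cst.
have hK t : is_hermitian (H0 x0 t + H1 t) by rewrite /is_hermitian adjD hH0 hH1.
pose a t := expect psi (adj (X t) *m Y t).
pose dd t := expect psi (adj (X t) *m Ga t *m X t).
pose b t := expect psi (adj (X t) *m Ga t *m Y t).
pose nn t := expect psi (adj (Y t) *m Ga t *m Y t).
have ce (U V : R -> 'M[R[i]]_n) : mcontinuous U -> mcontinuous V ->
    ccontinuous (fun t => expect psi (adj (U t) *m Ga t *m V t)).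
  move=> cU cV; apply: ccontinuous_expect; apply: mcontinuousM => //.
  by apply: mcontinuousM => //; exact: mcontinuous_adj.
have [cRd _] := ce _ _ cX cX; have [cRb cIb] := ce _ _ cX cY.
have [cRn _] := ce _ _ cY cY.
have da (t : R) : is_derive t 1 (fun s => complex.Re (a s)) (- complex.Re (b t)).
  have [+ _] := has_cderiv_expect psi
    (has_mderivM (has_mderiv_adj (dtdM x0 t)) (dtM x0 t)).
  rewrite (Re_expect_schrodinger psi (X t) (Y t) _ (hK t) (hGa t)).
  rewrite [X in _ - X]Im_expect_herm ?subr0//.
  by rewrite /is_hermitian !adjM !adjK hdH0 mulmxA.
have dn (t : R) : is_derive t 1
    (fun s => complex.Re (expect psi (adj (Y s) *m Y s))) (- complex.Re (nn t)).
  have := dtM x0 t; rewrite -[X in _ *: X]addr0 => dY.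
  have [+ _] := has_cderiv_expect psi
    (has_mderivM (has_mderiv_adj dY) (dtM x0 t)).
  rewrite (Re_expect_schrodinger psi (Y t) (Y t) 0 (hK t) (hGa t)).
  by rewrite adj0 mul0mx expect0 subr0.
pose I (f : R -> R) : R := Rintegral lebesgue_measure `[0, T]%classic f.
pose D := I (fun t => complex.Re (dd t)).
pose bi := I (fun t => complex.Im (b t)).
pose ar := complex.Re (a T); pose ai := complex.Im (a T).
pose e := complex.Re (E x0).
have IRb : I (fun t => complex.Re (b t)) = - ar.
  rewrite /I (Rintegral_FTC2N T0 cRb da).
  by rewrite /ar /a X0 adj0 mul0mx expect0 sub0r.
have IRn : I (fun t => complex.Re (nn t)) = 1 - e.
  rewrite /I (Rintegral_FTC2N T0 cRn dn).
  by congr (_ - _); rewrite /Y M0 mulmx1 /adj map_mx1 trmx1 psi1.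
have [e0 Ee] : 0 < e /\ E x0 = cR e.
  move: E0; rewrite ltcE => /andP[/eqP Ei Er]; split => //.
  by apply: complexP => //; rewrite Ei.
have Qint (w : R[i]) :
    I (fun t => complex.Re (expect psi
      (adj (X t + w *: Y t) *m Ga t *m (X t + w *: Y t)))) =
    D + 2 * (complex.Re w * - ar - complex.Im w * bi) +
    (complex.Re w ^+ 2 + complex.Im w ^+ 2) * (1 - e).
  rewrite -IRb -IRn.
  apply: etrans (Rintegral_quadratic T _ _ _ cRd cRb cIb cRn).
  by congr I; apply/funext => t; exact: Re_expect_quadratic.
have q0 (w : R[i]) t : 0 <= complex.Re (expect psi
      (adj (X t + w *: Y t) *m Ga t *m (X t + w *: Y t))).
  rewrite Re_expect_Lsq sumr_ge0// => j _.
  by rewrite mulr_ge0 ?Re_expect_adjM_ge0.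
have Q p q : 0 <= D + 2 * (p * - ar - q * bi) + (p ^+ 2 + q ^+ 2) * (1 - e).
  by have := Qint (Complex p q) => /= <-; apply: Rintegral_ge0 => t _; exact: q0.
have FE : F = Complex (- ai) ar.
  rewrite /F; apply: complexP;
    by rewrite ?cReM ?cImM/= !(mul0r, mul1r, sub0r, add0r).
have FOE : FO = cR (- (ai + bi)).
  rewrite /FO FE; apply: complexP; rewrite ?cReD ?cImD ?cReM ?cImM/=.
    by rewrite /bi/= mul0r mul1r sub0r opprD.
  rewrite mul0r mul1r add0r -/(I _).
  by rewrite -[X in _ + X]/(I (fun t => complex.Re (b t))) IRb subrr.
have GOE : GO = G + cR D.
  rewrite /GO; congr (_ + _); apply: complexP => //=.
  under eq_Rintegral => t _.
    rewrite Im_expect_herm; last by rewrite /is_hermitian !adjM adjK hGa mulmxA.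
    over.
  by rewrite Rintegral_cst//= mul0r.
have thE : dtheta = cR (ai / e).
  by rewrite /dtheta FE Ee cRN cR_div opprK.
have lossless : 4 * (G - `|F| ^+ 2 / E x0) = 4 * (GO - FO ^+ 2) <->
    D + (ar ^+ 2 + ai ^+ 2) / e = (ai + bi) ^+ 2.
  rewrite GOE sqr_norm_cR FE /= FOE Ee cR_div cR_sqr !sqrrN [ai ^+ 2 + _]addrC.
  exact: eq_mul4_subcR.
have Wpsi t : (X t + (iC * dtheta) *: Y t) *m psi = xi t.
  by rewrite mulmxDl -scalemxAl.
have wth : iC * dtheta = Complex 0 (ai / e).
  rewrite thE; apply: complexP;
    by rewrite ?cReM ?cImM/= !(mul0r, mul1r, mulr0, add0r, subr0).
have dE : has_cderiv E x0 (cR (2 * ar)).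
  have := has_cderiv_expect psi
    (has_mderivM (has_mderiv_adj (dxM x0 T)) (dxM x0 T)).
  rewrite expectD; set z := expect _ _ + _; suff -> : z = cR (2 * ar) by [].
  have -> : z = a T + Num.conj (a T) by rewrite -expect_adj adjM adjK.
  by apply: complexP; rewrite ?cReD ?cImD ?cRe_conj ?cIm_conj/= -?/ar; ring.
have ar0P : ar = 0 <-> has_cderiv E x0 0.
  split=> [ar0|/(has_cderiv_unique dE) [/eqP]].
    by move: dE; rewrite ar0 mulr0.
  by rewrite mulf_eq0 pnatr_eq0 => /eqP.
apply: iff_trans lossless _; apply: iff_trans (quadratic_lossless ai e0 Q) _.
have := Qint (iC * dtheta); rewrite wth /= -wth => <-.
pose W t := X t + (iC * dtheta) *: Y t.
have cq : continuous
    (fun t => complex.Re (expect psi (adj (W t) *m Ga t *m W t))).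
  have cW : mcontinuous W by apply: mcontinuousD => //; exact: mcontinuousZ.
  by have [] := ce _ _ cW cW.
split=> -[/ar0P dE0 h]; split=> //.
- move=> j t tT gj.
  have := continuous_ge0_Rintegral_eq0 T0 cq (q0 _) h tT.
  rewrite Re_expect_Lsq => /eqP.
  rewrite psumr_eq0 => [/allP/(_ j)|i _]; last first.
    by rewrite mulr_ge0 ?Re_expect_adjM_ge0.
  rewrite mem_index_enum => /(_ isT); rewrite /= mulf_eq0 gt_eqF//= => /eqP.
  by move=> /Re_expect_adjM_eq0; rewrite -mulmxA Wpsi.
- rewrite /I; under eq_Rintegral => t.
  rewrite inE /= in_itv/= => tT; rewrite Re_expect_Lsq big1 => [|j _].
    over.
  have := gam0 j t; rewrite le_eqVlt => /predU1P[<-|gj]; first by rewrite mul0r.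
  by rewrite (Re_expect_adjM_eq0 _ _).2 ?mulr0// -mulmxA Wpsi h.
by rewrite Rintegral_cst// mul0r.
Qed.
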